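(* Let $a,m\in\mathbb R$ and $n\in\mathbb N$. Let $\mathcal A=\{A_1,A_2,\dots,A_q\}$ and $\mathcal B=\{B_1,B_2,\dots,B_q\}$ be non-empty families of subsets of $[n]$ (so $q\geq 1$). Suppose that $A_i\neq\varnothing$ for all $i$, and that for all $j,k\in\{1,\dots,q\}$, $A_j\subseteq B_k$ if and only if $j=k$. If $ak+m\neq 0$ for all integers $k$ with $\min_{A\in\mathcal A}|A|\leq k\leq n$, then $$\sum_{i=1}^q (a|A_i|+m)\,g_{a,m}(n-|B_i|+|A_i|,\,|A_i|)+\sum_{X\in U_n(\mathcal A)\setminus D_n(\mathcal B)}\bigl(a|Z_{\mathcal A}(X)|+m\bigr)\,g_{a,m}(n,|X|)=1.$$
   Context: $[n]=\{1,2,\dots,n\}$, with $n\geq 1$. For a non-empty family $\mathcal F$ of subsets of $[n]$, the downset is $D_n(\mathcal F)=\{Y\subseteq[n] : Y\subseteq F \text{ for some } F\in\mathcal F\}$ and the upset is $U_n(\mathcal F)=\{Y\subseteq[n] : Y\supseteq F \text{ for some } F\in\mathcal F\}$. For $X\subseteq[n]$, set $Z_{\mathcal F}(X)=\varnothing$ if $X\notin U_n(\mathcal F)$, and $Z_{\mathcal F}(X)=\bigcap_{F\in\mathcal F,\,F\subseteq X}F$ otherwise. For $a,m\in\mathbb R$ and integers $l\leq n$ such that $ak+m\neq 0$ for $k=l,l+1,\dots,n$, define $$g_{a,m}(n,l)=\frac{(n-l)!\,a^{n-l}}{\prod_{k=l}^{n}(ak+m)},$$ with the convention $a^0=1$ (including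 $0^0=1$). *)

(* Defs.v *)
From HB Require Import structures.
From mathcomp Require Import all_boot all_order all_algebra.
From mathcomp Require Import reals.

Set Implicit Arguments.
Unset Strict Implicit.
Unset Printing Implicit Defensive.

Import Order.TTheory GRing.Theory Num.Theory.

Local Open Scope ring_scope.

(* The ground set [n] = {1, ..., n} is represented by 'I_n = {0, ..., n-1}. *)

Definition downset (n : nat) (F : {set {set 'I_n}}) : {set {set 'I_n}} :=
  [set Y : {set 'I_n} | [exists G in F, Y \subset G]].

Definition upset (n : nat) (F : {set {set 'I_n}}) : {set {set 'I_n}} :=
  [set Y : {set 'I_n} | [exists G in F, G \subset Y]].

Definition Zcap (n : nat) (F : {set {set 'I_n}}) (X : {set 'I_n}) : {set 'I_n} :=
  if X \in upset F then \bigcap_(G in F | G \subset X) G else set0.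

(* The default value n does not affect the minimum of a non-empty family,
   since #|G| <= n for every G : {set 'I_n}. *)
Definition min_card (n : nat) (F : {set {set 'I_n}}) : nat :=
  \big[minn/n]_(G in F) #|G|.

(* Meaningful for l <= n and a * k + m != 0 for all l <= k <= n. *)
Definition g (R : realType) (a m : R) (n l : nat) : R :=
  ((n - l)`!%:R * a ^+ (n - l)) / \prod_(l <= k < n.+1) (a * k%:R + m).

(* Main.v *)
(** Put w k = a k + m.  Since w l * g n l = (n - l) a g n (l + 1) for l < n and
    w n * g n n = 1, the sum of w |X| * g n |X| over an upset U telescopes along
    the covering pairs X < X + y to 1 plus the sum over Y in U of
    a g n |Y| times the number of y in Y with Y - y in U.  These y are the
    elements of Y outside Z(Y), so the sum of (a |Z(X)| + m) g n |X| over U is 1.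
    The members of U(A) that lie in D(B) split into the disjoint intervals
    [A_i, B_i], on which Z is constantly A_i, and Pascal's rule
    g n l + g n (l + 1) = g (n - 1) l sums g over such an interval. *)
Require Import Defs.
From HB Require Import structures.
From mathcomp Require Import all_boot all_order all_algebra.
From mathcomp Require Import reals.
From mathcomp Require Import ring zify.

Set Implicit Arguments.
Unset Strict Implicit.
Unset Printing Implicit Defensive.

Import Order.TTheory GRing.Theory Num.Theory.

Local Open Scope ring_scope.

Section WeightFunction.

Variables (R : realType) (a m : R).

Lemma mul_g_diag (n : nat) : a * n%:R + m != 0 -> (a * n%:R + m) * g a m n n = 1.
Proof. by move=> wn0; rewrite /g subnn big_nat1 fact0 expr0 mul1r mul1r divff. Qed.

Lemma mul_g_step (n l : nat) : (l < n)%N -> a * l%:R + m != 0 ->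
  (a * l%:R + m) * g a m n l = (n - l)%:R * a * g a m n l.+1.
Proof.
move=> ltln wl0; rewrite /g big_ltn 1?ltnW // -(subnSK ltln) factS natrM exprS.
by rewrite invfM; move: (\prod_(_ <= _ < _) _)^-1 => P; field.
Qed.

(** Over the common denominator of the factors [l] to [n.+1], the identity reduces to w (n + 1) = (n
    + 1 - l) a + w l, where w k = a k + m. *)
Lemma g_pascal (n l : nat) : (l <= n)%N ->
    (forall k, (l <= k <= n.+1)%N -> a * k%:R + m != 0) ->
  g a m n.+1 l + g a m n.+1 l.+1 = g a m n l.
Proof.
move=> leln w0.
have wl0 : a * l%:R + m != 0 by apply: w0; lia.
have wn0 : a * n.+1%:R + m != 0 by apply: w0; lia.
rewrite /g subSS subSn // factS natrM exprS big_ltn 1?leqW //.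
rewrite [in RHS]big_ltn // (big_nat_recr n.+1) //= !invfM.
move: (\prod_(_ <= _ < _) _)^-1 => P.
have wE : a * n.+1%:R + m = (n - l).+1%:R * a + (a * l%:R + m).
  by rewrite -subSn // natrB 1?leqW //; ring.
rewrite wE in wn0 *; move: (a * l%:R + m) wl0 wn0 => w wl0 wn0.
by field; rewrite nat1r wl0.
Qed.

(** Induction on the size of [B :\: A]: an element [x] of it splits the interval into [[x |: A],
    [B]] and [[A], [B :\ x]]. *)
Lemma sum_g_interval (n : nat) (A B : {set 'I_n}) : A \subset B ->
    (forall k, (#|A| <= k <= n)%N -> a * k%:R + m != 0) ->
  \sum_(X : {set 'I_n} | (A \subset X) && (X \subset B)) g a m n #|X|
  = g a m (n - #|B| + #|A|) #|A|.
Proof.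
have [d] := ubnP #|B :\: A|; elim: d => // d IHd in A B *.
rewrite ltnS => cardBA sAB w0.
have leBn : (#|B| <= n)%N by rewrite -[leqRHS]card_ord max_card.
have [BA0 | [x]] := set_0Vmem (B :\: A).
  have AB : A = B by apply/eqP; rewrite eqEsubset sAB -setD_eq0 BA0 eqxx.
  rewrite (big_pred1 A) => [|X]; first by rewrite -AB subnK // AB.
  by rewrite /= -AB eqEsubset andbC.
rewrite inE => /andP[xA xB].
have cB : #|B| = #|B :\ x|.+1 by rewrite (cardsD1 x B) xB.
have cxA : #|x |: A| = #|A|.+1 by rewrite cardsU1 xA.
have sABx : A \subset B :\ x by rewrite subsetD1 sAB xA.
have leABx := subset_leq_card sABx.
rewrite (bigID (fun X : {set 'I_n} => x \in X)) /=.
rewrite (eq_bigl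
  (fun X : {set 'I_n} => (x |: A \subset X) && (X \subset B))); last first.
  by move=> X; rewrite subUset sub1set andbAC [_ && (x \in X)]andbC.
rewrite [X in _ + X](eq_bigl
  (fun X : {set 'I_n} => (A \subset X) && (X \subset B :\ x))); last first.
  by move=> X; rewrite subsetD1 andbA.
rewrite !IHd //; last 4 first.
- by apply: leq_trans cardBA; rewrite proper_card // properE setSD ?subD1set //=;
    apply/subsetPn; exists x; rewrite !inE ?eqxx ?xA ?xB.
- by apply: leq_trans cardBA; rewrite proper_card // properE setDS ?subsetUr //=;
    apply/subsetPn; exists x; rewrite !inE ?eqxx ?xA ?xB.
- by rewrite subUset sub1set xB.
- by move=> k; rewrite cxA => /andP[/ltnW Ak kn]; apply: w0; rewrite Ak.
(* Adding [x] to [A] and removing it from [B] both raise the first argument of [g] by one, so the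
   two values are the left side of [g_pascal] at n - |B| + |A|. *)
have ltBxn : (#|B :\ x| < n)%N by rewrite -cB.
rewrite cxA addrC -(subnSK ltBxn) -cB addSn addnS.
apply: g_pascal => [|k /andP[Ak kn]]; first exact: leq_addl.
apply: w0; rewrite Ak; apply: leq_trans kn _.
by rewrite -addnS -[leqRHS](subnK leBn) leq_add2l cB ltnS.
Qed.

End WeightFunction.

Section Upsets.

Variables (n : nat) (F : {set {set 'I_n}}).

Lemma upsetP (X : {set 'I_n}) :
  reflect (exists2 G, G \in F & G \subset X) (X \in upset F).
Proof. by rewrite inE; apply: exists_inP. Qed.

Lemma min_card_le (G : {set 'I_n}) : G \in F -> (min_card F <= #|G|)%N.
Proof.
(* The start value [n] is not neutral for [minn] on all naturals, hence an induction on the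
   enumeration instead of monoid laws. *)
move=> GF; rewrite /min_card; have := mem_index_enum G.
elim: (index_enum _) => // H r IHr; rewrite big_cons inE.
case/predU1P=> [<- | /IHr leG]; first by rewrite GF geq_minl.
by case: ifP => // _; rewrite geq_min leG orbT.
Qed.

Lemma upset_min_card (X : {set 'I_n}) : X \in upset F -> (min_card F <= #|X|)%N.
Proof. by case/upsetP=> G /min_card_le FG /subset_leq_card; apply: leq_trans. Qed.

Lemma upsetS (X Y : {set 'I_n}) : X \subset Y -> X \in upset F -> Y \in upset F.
Proof.
by move=> sXY /upsetP[G GF sGX]; apply/upsetP; exists G => //; apply: subset_trans sXY.
Qed.

Lemma Zcap_sub (X : {set 'I_n}) : Zcap F X \subset X.
Proof.
rewrite /Zcap; case: ifP => [/upsetP[G GF sGX]|_]; last exact: sub0set.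
by apply: subset_trans (sGX); apply: bigcap_inf; rewrite GF.
Qed.

(** Either side says that some member of [F] inside [X] avoids [y]. *)
Lemma upset_setD1 (X : {set 'I_n}) (y : 'I_n) : X \in upset F ->
  (X :\ y \in upset F) = (y \notin Zcap F X).
Proof.
move=> UX; rewrite /Zcap UX; apply/idP/idP.
  case/upsetP=> G GF; rewrite subsetD1 => /andP[sGX yG].
  by apply: contra yG => /bigcapP; apply; rewrite GF.
apply: contraR => /upsetP UXy; apply/bigcapP => G /andP[GF sGX].
by apply/negPn/negP => yG; apply: UXy; exists G; rewrite // subsetD1 sGX.
Qed.

(** Double counting of the covering pairs inside the upset, grouped by lower set on the left and by
    upper set on the right. *)
Lemma sum_upset_covers (V : nmodType) (h : {set 'I_n} -> V) :
  \sum_(X in upset F) \sum_(y | y \notin X) h (y |: X)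
  = \sum_(Y in upset F) h Y *+ #|Y :\: Zcap F Y|.
Proof.
under [RHS]eq_bigr do rewrite -sumr_const.
rewrite (exchange_big_dep predT) //= [RHS](exchange_big_dep predT) //=.
apply: eq_bigr => y _.
(* For fixed [y], the sets X without [y] correspond to the sets Y = X + y containing [y]. *)
rewrite (reindex_onto (fun Y => Y :\ y) (fun X => y |: X)) /=; last first.
  by move=> X /andP[_ yX]; rewrite setU1K.
apply: eq_big => [Y | Y /andP[_ /eqP->] //].
rewrite setD11 andbT in_setD.
have [yY | yY] := boolP (y \in Y); last first.
  rewrite !andbF; apply/negbTE; apply: contra yY => /andP[_ /eqP<-].
  by rewrite setU11.
rewrite setD1K // eqxx !andbT; have [UY | UY] := boolP (Y \in upset F).
  exact: upset_setD1.
by apply: contraNF UY; apply: upsetS; rewrite subD1set.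
Qed.

Lemma sum_upset_Zcap (R : realType) (a m : R) : F != set0 ->
    (forall k, (min_card F <= k <= n)%N -> a * k%:R + m != 0) ->
  \sum_(X in upset F) (a * #|Zcap F X|%:R + m) * g a m n #|X| = 1.
Proof.
move=> /set0Pn[G GF] w0.
have UT : [set: 'I_n] \in upset F by apply/upsetP; exists G; rewrite ?subsetT.
have Z_split X : (a * #|Zcap F X|%:R + m) * g a m n #|X| =
    (a * #|X|%:R + m) * g a m n #|X| - (a * g a m n #|X|) *+ #|X :\: Zcap F X|.
  rewrite cardsDS ?Zcap_sub // -[X in _ - X]mulr_natr
    natrB ?subset_leq_card ?Zcap_sub //.
  by ring.
under eq_bigr do rewrite Z_split.
(* The full set supplies the 1: its first term is w n * g n n, and no [y] lies outside it. For any
   other X, the n - |X| covers cancel the first term. *)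
rewrite sumrB -sum_upset_covers (bigD1 setT) //=.
rewrite [X in _ - X](bigD1 setT) //= [X in _ - (X + _)]big1; last first.
  by move=> y; rewrite inE.
rewrite add0r cardsT card_ord mul_g_diag; last first.
  by apply: w0; rewrite leqnn andbT -[leqRHS]card_ord -cardsT upset_min_card.
apply/eqP; rewrite subr_eq; apply/eqP; congr (1 + _).
apply: eq_bigr => X /andP[UX XT].
have ltXn : (#|X| < n)%N.
  by rewrite -[ltnRHS]card_ord -cardsT proper_card // properT.
rewrite mul_g_step //; last by apply: w0; rewrite upset_min_card // ltnW.
under eq_bigr => y yX do rewrite cardsU1 yX add1n.
rewrite (eq_bigl (fun y => y \in ~: X)); last by move=> y; rewrite inE.
by rewrite sumr_const [#|~: X|]cardsCs setCK card_ord -mulrA mulr_natl.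
Qed.

End Upsets.

Section CrossFamilies.

Variables (n q : nat) (A B : 'I_q -> {set 'I_n}).
Hypothesis AB : forall j k, A j \subset B k <-> j = k.

Let FA := [set A i | i : 'I_q].
Let FB := [set B i | i : 'I_q].

(** If [A j] also lies in [X], then it lies in [B i], so j = i: the intersection has a single
    member. *)
Lemma Zcap_interval (i : 'I_q) (X : {set 'I_n}) :
  A i \subset X -> X \subset B i -> Zcap FA X = A i.
Proof.
move=> sAX sXB; rewrite /Zcap ifT; last first.
  by apply/upsetP; exists (A i); rewrite ?imset_f.
apply: big_pred1 => G /=; apply/andP/eqP => [[/imsetP[j _ ->] sAjX] | ->].
  by congr A; apply/AB; apply: subset_trans sXB.
by rewrite imset_f.
Qed.

(** A set between [A i] and [B j] forces i = j, so each [X] on the left lies in exactly one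
    interval. *)
Lemma sum_upset_downset (V : nmodType) (h : {set 'I_n} -> V) :
  \sum_(X in upset FA :&: downset FB) h X
  = \sum_i \sum_(X : {set 'I_n} | (A i \subset X) && (X \subset B i)) h X.
Proof.
rewrite [RHS](exchange_big_dep (mem (upset FA :&: downset FB))) /=; last first.
  move=> i X _ /andP[sAX sXB]; rewrite inE; apply/andP; split.
    by apply/upsetP; exists (A i); rewrite ?imset_f.
  by rewrite inE; apply/exists_inP; exists (B i); rewrite ?imset_f.
apply: eq_bigr => X; rewrite inE => /andP[/upsetP[_ /imsetP[i _ ->] sAX]].
rewrite inE => /exists_inP[_ /imsetP[j _ ->] sXB].
have ij : i = j by apply/AB; apply: subset_trans sXB.
rewrite -{j}ij in sXB; rewrite (big_pred1 i) // => k /=.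
apply/andP/eqP => [[_ sXBk] | -> //].
by apply/esym/AB; apply: subset_trans sXBk.
Qed.

End CrossFamilies.

Theorem theorem2p7 (R : realType) (a m : R) (n q : nat)
    (A B : 'I_q -> {set 'I_n}) :
  (1 <= n)%N -> (1 <= q)%N ->
  (forall i : 'I_q, A i <> set0) ->
  (forall j k : 'I_q, A j \subset B k <-> j = k) ->
  (forall k : nat, (min_card [set A i | i : 'I_q] <= k <= n)%N ->
     a * k%:R + m <> 0) ->
  \sum_(i < q) (a * #|A i|%:R + m) * g a m (n - #|B i| + #|A i|) #|A i|
  + \sum_(X in upset [set A i | i : 'I_q] :\: downset [set B i | i : 'I_q])
      (a * #|Zcap [set A i | i : 'I_q] X|%:R + m) * g a m n #|X|
  = 1.
Proof.
move=> _ q_gt0 _ AB w0.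
have FA0 : [set A i | i : 'I_q] != set0.
  by apply/set0Pn; exists (A (Ordinal q_gt0)); rewrite imset_f.
have w0' k : (min_card [set A i | i : 'I_q] <= k <= n)%N -> a * k%:R + m != 0.
  by move=> /w0/eqP.
(* The right-hand 1 is expanded into the sum over the whole upset, whose part outside the downset is
   the second sum of the claim. *)
rewrite -[RHS](sum_upset_Zcap FA0 w0').
rewrite [RHS](big_setID (downset [set B i | i : 'I_q])) /=; congr (_ + _).
rewrite (sum_upset_downset AB); apply: eq_bigr => i _.
rewrite -sum_g_interval; last 2 first.
- by apply/AB.
- move=> k /andP[Ak kn]; apply: w0'; rewrite kn andbT.
  by apply: leq_trans Ak; rewrite min_card_le // imset_f.
rewrite mulr_sumr; apply: eq_bigr => X /andP[sAX sXB].
by rewrite (Zcap_interval AB sAX sXB).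
Qed.
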